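(* Let $\mathbb F_2$ be the free group with free generators $a,b$. Let $\alpha,\beta:\mathbb Z\to\mathbb Z$ be bounded odd functions such that $\alpha(n)\neq0$ for all but finitely many $n\in\mathbb Z$, and let $f:\mathbb F_2\to\mathbb Z$ be given by $$f(a^{n_1}b^{m_1}\cdots a^{n_k}b^{m_k}):=\sum_{i=1}^k\bigl(\alpha(n_i)+\beta(m_i)\bigr),$$ where $n_i\neq0$ for $1<i\leq k$ and $m_i\neq0$ for $1\leq i<k$. Let $M$ be the two-sorted structure with sorts the groups $(\mathbb F_2,\cdot)$ and $(\mathbb Z,+)$ together with the function $f$ (or any expansion of this structure), let $M^*\succ M$ be a monster model with corresponding sorts $\mathbb F_2^*,\mathbb Z^*$ and function $f^*:\mathbb F_2^*\to\mathbb Z^*$, let $X\subseteq\mathbb F_2^*\times\mathbb Z^*$ be the graph of $f^*$ (which is a $\emptyset$-definable approximate subgroup), and let $H:=\langle X\rangle$ be the subgroup of $\mathbb F_2^*\times\mathbb Z^*$ generated by $X$. Then for every $m\geq1$, $H^{000}_\emptyset$ is not contained in $X^m$.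
   Context: A monster model is $\kappa$-saturated and strongly $\kappa$-homogeneous for a sufficiently large cardinal $\kappa$; bounded means of cardinality $<\kappa$. An approximate subgroup of a group is a symmetric subset $X$ such that $X^2=XX$ is contained in finitely many left translates of $X$. $X^m$ denotes the $m$-fold product set. $H^{000}_\emptyset$ is the smallest $\mathrm{Aut}(M^* )$-invariant subgroup of $H$ of bounded index in $H$ (it always exists). *)

(* Defs.v *)
From HB Require Import structures.
From mathcomp Require Import all_boot all_order all_algebra.
From mathcomp Require Export boolp classical_sets functions cardinality.

Set Implicit Arguments.
Unset Strict Implicit.
Unset Printing Implicit Defensive.

Local Open Scope classical_set_scope.
Local Open Scope card_scope.

(* A cardinal kappa is represented by (the full set of) a type K. *)
Definition card_lt (T U : Type) (A : set T) (B : set U) : Prop :=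
  (A #<= B) /\ ~ (B #<= A).

(** * Many-sorted first-order logic *)

Record language (S : Type) := Language {
  fun_symb : Type;
  fun_ar : fun_symb -> nat;
  fun_dom : forall g : fun_symb, 'I_(fun_ar g) -> S;
  fun_cod : fun_symb -> S;
  rel_symb : Type;
  rel_ar : rel_symb -> nat;
  rel_dom : forall r : rel_symb, 'I_(rel_ar r) -> S }.

Arguments fun_dom {S l g}.
Arguments rel_dom {S l r}.

Record interp (S : Type) (L : language S) (C : S -> Type) := Interp {
  fun_interp : forall g : fun_symb L,
    (forall i : 'I_(fun_ar g), C (fun_dom i)) -> C (fun_cod g);
  rel_interp : forall r : rel_symb L,
    (forall i : 'I_(rel_ar r), C (rel_dom i)) -> Prop }.

Record structure (S : Type) (L : language S) := Structure {
  carrier :> S -> Type;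
  symbols : interp L carrier }.

Definition fun_of S (L : language S) (M : structure L) := fun_interp (symbols M).
Definition rel_of S (L : language S) (M : structure L) := rel_interp (symbols M).

(* [lang_add L E] adjoins the symbols of [E] to [L] (same sorts), and
   [expand M I] is the expansion of [M] in which the new symbols are
   interpreted by [I]. *)
Definition lang_add S (L E : language S) : language S := {|
  fun_symb := fun_symb L + fun_symb E;
  fun_ar g := match g with inl g => fun_ar g | inr g => fun_ar g end;
  fun_dom g := match g with inl g => @fun_dom _ _ g | inr g => @fun_dom _ _ g end;
  fun_cod g := match g with inl g => fun_cod g | inr g => fun_cod g end;
  rel_symb := rel_symb L + rel_symb E;
  rel_ar r := match r with inl r => rel_ar r | inr r => rel_ar r end;
  rel_dom r := match r with inl r => @rel_dom _ _ r | inr r => @rel_dom _ _ r end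
|}.

Definition expand S (L E : language S) (M : structure L) (I : interp E M) :
    structure (lang_add L E) := {|
  carrier := M;
  symbols := {|
    fun_interp := fun g : fun_symb (lang_add L E) =>
      match g with inl g => @fun_of _ _ M g | inr g => @fun_interp _ _ _ I g end;
    rel_interp := fun r : rel_symb (lang_add L E) =>
      match r with inl r => @rel_of _ _ M r | inr r => @rel_interp _ _ _ I r end
  |}
|}.

Section Logic.
Variables (S : eqType) (L : language S).

(* The variable [(s, n)] is the [n]-th variable of sort [s]. *)
Definition var : Type := (S * nat)%type.

Inductive term : S -> Type :=
| Var (x : var) : term x.1
| App (g : fun_symb L) (ts : forall i : 'I_(fun_ar g), term (fun_dom i)) :
    term (fun_cod g).

Inductive formula : Type :=
| FEq (s : S) (t u : term s)
| FRel (r : rel_symb L) (ts : forall i : 'I_(rel_ar r), term (rel_dom i))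
| FFalse
| FImp (phi psi : formula)
| FAll (x : var) (phi : formula).

Fixpoint tfree_in (x : var) (s : S) (t : term s) : Prop :=
  match t with
  | Var y => x = y
  | App g ts => exists i, tfree_in x (ts i)
  end.

Fixpoint free_in (x : var) (phi : formula) : Prop :=
  match phi with
  | FEq s t u => tfree_in x t \/ tfree_in x u
  | FRel r ts => exists i, tfree_in x (ts i)
  | FFalse => False
  | FImp phi psi => free_in x phi \/ free_in x psi
  | FAll y phi => x <> y /\ free_in x phi
  end.

Definition assignment (M : structure L) : Type := forall x : var, M x.1.

Fixpoint eval (M : structure L) (v : assignment M) (s : S) (t : term s) : M s :=
  match t with
  | Var x => v x
  | App g ts => fun_of (fun i => eval v (ts i))
  end.

(* [dfwith v a] is [v] with the value of the variable [x] replaced by [a]. *)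
Fixpoint sat (M : structure L) (v : assignment M) (phi : formula) : Prop :=
  match phi with
  | FEq s t u => eval v t = eval v u
  | FRel r ts => rel_of (fun i => eval v (ts i))
  | FFalse => False
  | FImp phi psi => sat v phi -> sat v psi
  | FAll x phi => forall a : M x.1, sat (dfwith v a : assignment M) phi
  end.

Definition elementary_embedding (M N : structure L)
    (j : forall s, M s -> N s) : Prop :=
  forall (phi : formula) (v : assignment M),
    sat v phi <-> sat (fun x => j x.1 (v x) : N x.1) phi.

Definition automorphism (M : structure L) (sigma : forall s, M s -> M s) : Prop :=
  [/\ forall s, bijective (sigma s),
      forall (g : fun_symb L) (a : forall i : 'I_(fun_ar g), M (fun_dom i)),
        sigma _ (fun_of a) = fun_of (fun i => sigma _ (a i)) &
      forall (r : rel_symb L) (a : forall i : 'I_(rel_ar r), M (rel_dom i)),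
        rel_of a <-> rel_of (fun i => sigma _ (a i))].

(* A parameter set, with elements of all sorts. *)
Definition params (M : structure L) : Type := set {s : S & M s}.

(* A formula in the free variable [x] with parameters from [M] is a formula
   together with an assignment giving the parameters. *)
Definition over (M : structure L) (A : params M) (x : var)
    (q : formula * assignment M) : Prop :=
  forall y, free_in y q.1 -> y <> x -> A (existT _ y.1 (q.2 y)).

Definition realizes (M : structure L) (x : var) (a : M x.1)
    (p : set (formula * assignment M)) : Prop :=
  forall q, p q -> sat (dfwith q.2 a : assignment M) q.1.

Definition saturated (K : Type) (M : structure L) : Prop :=
  forall (A : params M) (x : var) (p : set (formula * assignment M)),
    card_lt A [set: K] ->
    (forall q, p q -> over A x q) ->
    (forall p0, p0 `<=` p -> finite_set p0 -> exists a : M x.1, realizes a p0) ->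
    exists a : M x.1, realizes a p.

(* [h] is elementary as a partial map with domain [A]; its values outside [A]
   are irrelevant. *)
Definition partial_elementary (M : structure L) (A : params M)
    (h : forall s, M s -> M s) : Prop :=
  forall (phi : formula) (v : assignment M),
    (forall y, free_in y phi -> A (existT _ y.1 (v y))) ->
    (sat v phi <-> sat (fun y => h y.1 (v y) : M y.1) phi).

Definition strongly_homogeneous (K : Type) (M : structure L) : Prop :=
  forall (A : params M) (h : forall s, M s -> M s),
    card_lt A [set: K] -> partial_elementary A h ->
    exists2 sigma, automorphism sigma &
      forall s (a : M s), A (existT _ s a) -> sigma s a = h s a.

(* "Sufficiently large": kappa > 2^(|L| + aleph_0) (when there are at most
   countably many sorts), the usual bound which ensures that the components
   [_^000] exist. *)
Definition sufficiently_large (K : Type) : Prop :=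
  card_lt [set: set formula] [set: K].

Definition monster_model (K : Type) (M : structure L) : Prop :=
  [/\ sufficiently_large K, saturated K M & strongly_homogeneous K M].

Definition emptyset_definable2 (M : structure L) (s t : S)
    (X : set (M s * M t)) : Prop :=
  exists2 phi : formula,
    forall z, free_in z phi -> z = (s, 0) \/ z = (t, 1) &
    forall (v : assignment M) (a : M s) (b : M t),
      X (a, b) <->
      sat (dfwith (dfwith v (i := (s, 0)) a) (i := (t, 1)) b : assignment M) phi.

End Logic.

(** * Subsets of a group *)

(* The group is given by its multiplication [op] only; [op] is meant to satisfy
   the group axioms, which determine identity and inverses. *)
Section GroupSets.
Variables (T : Type) (op : T -> T -> T).

Definition identity (e : T) : Prop := forall x, op e x = x /\ op x e = x.

Definition inverses (x y : T) : Prop := identity (op x y) /\ identity (op y x).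

Definition subgroup (H : set T) : Prop :=
  [/\ forall e, identity e -> H e,
      forall x y, H x -> H y -> H (op x y) &
      forall x y, H x -> inverses x y -> H y].

Definition generated (X : set T) : set T :=
  \bigcap_(H in [set H | subgroup H /\ X `<=` H]) H.

Definition prod_set (X Y : set T) : set T := [set op x y | x in X & y in Y].

Definition pow_set (X : set T) (m : nat) : set T :=
  iterop m prod_set X identity.

Definition translate (g : T) (X : set T) : set T := op g @` X.

Definition approximate_subgroup (X : set T) : Prop :=
  (forall x y, X x -> inverses x y -> X y) /\
  exists2 F : set T, finite_set F & prod_set X X `<=` \bigcup_(g in F) translate g X.

(* The index of [G] in [H] is the cardinality of the set of left cosets. *)
Definition bounded_index (K : Type) (G H : set T) : Prop :=
  card_lt ((fun h => translate h G) @` H) [set: K].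

End GroupSets.

Definition free_on (F : groupType) (a b : F) : Prop :=
  forall (G : groupType) (x y : G), exists! h : F -> G,
    [/\ {morph h : u v / (u * v)%g}, h a = x & h b = y].

Definition expgz (G : groupType) (x : G) (n : int) : G :=
  match n with Posz k => (x ^+ k)%g | Negz k => (x ^- k.+1)%g end.

(** * The two-sorted structure *)

Inductive two_sorts := GSort | ZSort.

Definition bool_of_sort (s : two_sorts) : bool := if s is GSort then true else false.
Definition sort_of_bool (b : bool) : two_sorts := if b then GSort else ZSort.
Lemma bool_of_sortK : cancel bool_of_sort sort_of_bool.
Proof. by case. Qed.
HB.instance Definition _ := Equality.copy two_sorts (can_type bool_of_sortK).

Inductive base_symb := mul_symb | add_symb | f_symb.

Definition base_lang : language two_sorts := {|
  fun_symb := base_symb;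
  fun_ar g := match g with mul_symb => 2 | add_symb => 2 | f_symb => 1 end;
  fun_dom g _ :=
    match g with mul_symb => GSort | add_symb => ZSort | f_symb => GSort end;
  fun_cod g :=
    match g with mul_symb => GSort | add_symb => ZSort | f_symb => ZSort end;
  rel_symb := void;
  rel_ar r := match r with end;
  rel_dom r := match r with end
|}.

Definition base_carrier (F : groupType) (s : two_sorts) : Type :=
  match s with GSort => F | ZSort => int end.

Definition base_fun (F : groupType) (f : F -> int) (g : fun_symb base_lang) :
    (forall i : 'I_(fun_ar g), base_carrier F (fun_dom i)) ->
    base_carrier F (fun_cod g) :=
  match g as g0 return
    (forall i : 'I_(@fun_ar _ base_lang g0),
       base_carrier F (@fun_dom _ base_lang g0 i)) ->
    base_carrier F (@fun_cod _ base_lang g0) with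
  | mul_symb => fun x => (x ord0 * x ord_max)%g
  | add_symb => fun x => (x ord0 + x ord_max)%R
  | f_symb => fun x => f (x ord0)
  end.

Definition base_structure (F : groupType) (f : F -> int) :
    structure base_lang := {|
  carrier := base_carrier F;
  symbols := {|
    fun_interp := base_fun f;
    rel_interp := fun r : rel_symb base_lang => match r with end
  |}
|}.

Section Reducts.
Variables (E : language two_sorts) (N : structure (lang_add base_lang E)).

Definition args1 (T : Type) (x : T) (i : 'I_1) : T := x.
Definition args2 (T : Type) (x y : T) (i : 'I_2) : T := if i == ord0 then x else y.

Definition mul_of (x y : N GSort) : N GSort :=
  @fun_of _ _ N (inl mul_symb) (args2 x y).
Definition add_of (x y : N ZSort) : N ZSort :=
  @fun_of _ _ N (inl add_symb) (args2 x y).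
Definition f_of (x : N GSort) : N ZSort :=
  @fun_of _ _ N (inl f_symb) (args1 x).

Definition prod_op (p q : N GSort * N ZSort) : N GSort * N ZSort :=
  (mul_of p.1 q.1, add_of p.2 q.2).

Definition graph_f : set (N GSort * N ZSort) := [set p | p.2 = f_of p.1].

Definition aut_invariant (G : set (N GSort * N ZSort)) : Prop :=
  forall sigma, automorphism sigma ->
    [set (sigma GSort p.1, sigma ZSort p.2) | p in G] = G.

(* The invariant subgroups of [H] of bounded index, and the smallest of them,
   [H^000] over the empty set. *)
Definition invariant_bounded (K : Type) (H G : set (N GSort * N ZSort)) : Prop :=
  [/\ subgroup prod_op G, G `<=` H, aut_invariant G & bounded_index prod_op K G H].

Definition is_H000 (K : Type) (H G : set (N GSort * N ZSort)) : Prop :=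
  invariant_bounded K H G /\ forall G', invariant_bounded K H G' -> G `<=` G'.

End Reducts.

(* Main.v *)
Require Import Defs.
From HB Require Import structures.
From mathcomp Require Import all_boot all_order all_algebra zify.
From mathcomp Require Import boolp classical_sets functions cardinality.

(* Write [e] for the identity of F2* and [o] for the zero of Z*. Cancelling
   reduced words shows that [f] is a quasimorphism with [f (x^-1) = - f x], so
   that [X^m] lies within a standard integer distance of the graph of [f]. A
   subgroup [G] of bounded index contains points over some [u <> e] in the
   centralizer of [a] and some [v <> e] in the centralizer of [b], because by
   saturation these centralizers are too large to be separated by the cosets of
   [G]. On both centralizers [f] is bounded, so if [G <= X^m], all powers of
   these points stay near the graph, which forces them to be [(u, o)] and
   [(v, o)]. Then [f ((u^k v)^n)] and [f ((u^-k v)^n)] are bounded independently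
   of [n]; but for [u = a^r] and [v = b^s] they are
   [n (alpha (k r) + beta s)] and [n (- alpha (k r) + beta s)], so that
   [alpha (k r) = 0], which is false for large [k]. *)

Set Implicit Arguments.
Unset Strict Implicit.
Unset Printing Implicit Defensive.

Import Order.TTheory GRing.Theory Num.Theory.
Local Open Scope classical_set_scope.
Local Open Scope ring_scope.

(** * Groups *)

Section IntegerPowers.
Variable G : groupType.
Implicit Types (x : G) (m n : int).

Lemma expgzN x n : expgz x (- n) = (expgz x n)^-1%g.
Proof. by case: n => [[|n]|n] //=; rewrite ?invg1 ?invgK. Qed.

Lemma expgzS x n : expgz x (n + 1) = (expgz x n * x)%g.
Proof.
case: n => [n|[|n]].
- by rewrite -PoszD addn1 /= expgSr.
- by rewrite /= expg1 mulVg.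
- have -> : Negz n.+1 + 1 = Negz n by lia.
  by rewrite /= (expgS x n.+1) invgM mulgVK.
Qed.

Lemma expgzD x m n : expgz x (m + n) = (expgz x m * expgz x n)%g.
Proof.
elim: n => [|n IHn|n IHn]; first by rewrite addr0 mulg1.
- have -> : m + n.+1%:Z = m + n + 1 by lia.
  have -> : n.+1%:Z = n%:Z + 1 by lia.
  by rewrite !expgzS IHn mulgA.
- apply: (@mulIg _ x); rewrite -mulgA -!expgzS.
  have -> : m - n.+1%:Z + 1 = m - n%:Z by lia.
  by have -> : - n.+1%:Z + 1 = - n%:Z by lia.
Qed.

Lemma expgz_natM x n k : expgz x (n *+ k) = (expgz x n ^+ k)%g.
Proof. by elim: k => [|k IHk]; rewrite ?mulr0n // mulrS expgzD IHk expgS. Qed.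

End IntegerPowers.

Section Morphisms.
Variables (G H : groupType) (h : G -> H).
Hypothesis hM : {morph h : u v / (u * v)%g}.

Lemma morph_one : h 1%g = 1%g.
Proof. by apply: (@mulgI _ (h 1%g)); rewrite -hM !mulg1. Qed.

Lemma morph_expgz x n : h (expgz x n) = expgz (h x) n.
Proof.
elim: n => [|n IHn|n IHn]; first exact: morph_one.
- have -> : n.+1%:Z = n%:Z + 1 by lia.
  by rewrite !expgzS hM IHn.
- apply: (@mulIg _ (h x)); rewrite -expgzS -hM -expgzS.
  by have -> : - n.+1%:Z + 1 = - n%:Z by lia.
Qed.

End Morphisms.

Section SubgroupType.
Variables (G : groupType) (S : {pred G}).

(** A subgroup as a group in its own right, so that the universal property of a free group can be
    applied with it as target. The closure proof is a parameter of the type, from which the group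
    structure is then inferred. *)
Definition subgroup_type (_ : group_closed S) := {x : G | x \in S}.

Variable S_closed : group_closed S.
HB.instance Definition _ := SubChoice.on (subgroup_type S_closed).
HB.instance Definition _ :=
  SubChoice_isSubGroup.Build G S (subgroup_type S_closed) S_closed.

End SubgroupType.

(** Permutations of a possibly infinite set. The inverse is stored as data, so that the group
    operations are explicit. *)
Record bijection (T : Type) := Bijection {
  bij_fun :> T -> T;
  bij_inv : T -> T;
  bij_funK : cancel bij_fun bij_inv;
  bij_invK : cancel bij_inv bij_fun }.

Section BijectionGroup.
Variable T : Type.
Implicit Types p q : bijection T.

Lemma bijectionP p q : bij_fun p =1 bij_fun q -> p = q.
Proof.
case: p q => [f f' fK f'K] [g g' gK g'K] /= fg.
have {fg} fg : f = g by apply/funext.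
subst g; have gf : f' = g' by apply/funext => x; rewrite -[x in LHS]g'K fK.
by subst g'; congr Bijection; apply: Prop_irrelevance.
Qed.

Definition bij_id := @Bijection T id id (fun=> erefl) (fun=> erefl).
Definition bij_mul p q :=
  @Bijection T (p \o q) (bij_inv q \o bij_inv p)
    (can_comp (bij_funK p) (bij_funK q)) (can_comp (bij_invK q) (bij_invK p)).
Definition bij_opp p := Bijection (bij_invK p) (bij_funK p).

HB.instance Definition _ := gen_eqMixin (bijection T).
HB.instance Definition _ := gen_choiceMixin (bijection T).

Lemma bij_mulA : associative bij_mul.
Proof. by move=> p q r; apply: bijectionP. Qed.
Lemma bij_mul1 : left_id bij_id bij_mul.
Proof. by move=> p; apply: bijectionP. Qed.
Lemma bij_mulr1 : right_id bij_id bij_mul.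
Proof. by move=> p; apply: bijectionP. Qed.
Lemma bij_mulV : left_inverse bij_id bij_opp bij_mul.
Proof. by move=> p; apply: bijectionP => x; apply: bij_funK. Qed.
Lemma bij_mulVr : right_inverse bij_id bij_opp bij_mul.
Proof. by move=> p; apply: bijectionP => x; apply: bij_invK. Qed.
HB.instance Definition _ :=
  isGroup.Build (bijection T) bij_mulA bij_mul1 bij_mulr1 bij_mulV bij_mulVr.

End BijectionGroup.

(** * Shears of the integer plane *)

Lemma shear_can (c : int) :
  cancel (fun v : int * int => (v.1 + c * v.2, v.2))
         (fun v => (v.1 - c * v.2, v.2)).
Proof. by case=> x y /=; rewrite addrK. Qed.

Lemma shear_canV (c : int) :
  cancel (fun v : int * int => (v.1 - c * v.2, v.2))
         (fun v => (v.1 + c * v.2, v.2)).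
Proof. by case=> x y /=; rewrite subrK. Qed.

Definition upper_shear := Bijection (shear_can 2) (shear_canV 2).

Lemma swap_can (f g : int * int -> int * int) : cancel f g ->
  cancel (fun v => let w := f (v.2, v.1) in (w.2, w.1))
         (fun v => let w := g (v.2, v.1) in (w.2, w.1)).
Proof. by move=> fK [x y] /=; rewrite -surjective_pairing fK. Qed.

(** The conjugate of [upper_shear] by the exchange of the two coordinates. *)
Definition lower_shear :=
  Bijection (swap_can (shear_can 2)) (swap_can (shear_canV 2)).

Lemma upper_shearX n v :
  bij_fun (expgz upper_shear n) v = (v.1 + 2 * n * v.2, v.2).
Proof.
elim: n v => [|n IHn|n IHn] v.
- by rewrite mulr0 mul0r addr0 -surjective_pairing.
- have -> : n.+1%:Z = n%:Z + 1 by lia.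
  rewrite expgzS; transitivity (bij_fun (expgz upper_shear n) (upper_shear v)) => //.
  by rewrite IHn /=; congr pair; lia.
(* For a negative exponent [v] is written as the image of a point [w] under the shear, and this
   shear cancels one inverse. *)
- have -> : v = upper_shear (v.1 - 2 * v.2, v.2) by rewrite /= subrK -surjective_pairing.
  set w := (_, _).
  transitivity (bij_fun (expgz upper_shear (- n%:Z)) w).
    have -> : - n%:Z = - n.+1%:Z + 1 by lia.
    by rewrite expgzS.
  by rewrite IHn /=; congr pair; lia.
Qed.

Lemma lower_shearX n v :
  bij_fun (expgz lower_shear n) v = (v.1, v.2 + 2 * n * v.1).
Proof.
elim: n v => [|n IHn|n IHn] v.
- by rewrite mulr0 mul0r addr0 -surjective_pairing.
- have -> : n.+1%:Z = n%:Z + 1 by lia.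
  rewrite expgzS; transitivity (bij_fun (expgz lower_shear n) (lower_shear v)) => //.
  by rewrite IHn /=; congr pair; lia.
- have -> : v = lower_shear (v.1, v.2 - 2 * v.1) by rewrite /= subrK -surjective_pairing.
  set w := (_, _).
  transitivity (bij_fun (expgz lower_shear (- n%:Z)) w).
    have -> : - n%:Z = - n.+1%:Z + 1 by lia.
    by rewrite expgzS.
  by rewrite IHn /=; congr pair; lia.
Qed.

(** * Words in a free group of rank two *)

(* A word is a list of syllables: [(true, n)] stands for [a ^ n] and
   [(false, n)] for [b ^ n]. *)
Definition word := seq (bool * int).

Definition reduced (w : word) : bool :=
  all (fun s => s.2 != 0) w && sorted (fun s t => s.1 != t.1) w.

(** With [u] stored backwards, this says that nothing merges where [rev u] meets [v]. *)
Definition heads_differ (u v : word) : bool :=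
  if (u, v) is (s :: _, t :: _) then s.1 != t.1 else true.

Lemma reduced_cons s w :
  reduced (s :: w) = [&& s.2 != 0, heads_differ [:: s] w & reduced w].
Proof.
rewrite /reduced; case: w => [|t w] /=; rewrite ?andbT // -andbA.
by congr (_ && _); apply: andbCA.
Qed.

Lemma reduced_rev w : reduced (rev w) = reduced w.
Proof.
rewrite /reduced all_rev rev_sorted; congr (_ && _).
by case: w => //= s w; apply: eq_path => x y; rewrite eq_sym.
Qed.

Lemma reduced_catrev u v :
  reduced u -> reduced v -> heads_differ u v -> reduced (catrev u v).
Proof.
elim: u v => [//|s u IHu] v; rewrite reduced_cons => /and3P[s0 su ru] rv sv.
apply: IHu => //; first by rewrite reduced_cons; apply/and3P.
by case: u su {ru sv} => [|t u] //; rewrite /heads_differ eq_sym.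
Qed.

(** The order of the syllables is kept, so that the word for the inverse is [rev (inv_word w)]. *)
Definition inv_word (w : word) : word := [seq (s.1, - s.2) | s <- w].

Lemma reduced_inv_word w : reduced (inv_word w) = reduced w.
Proof.
elim: w => [//|s w IHw]; rewrite /= !reduced_cons IHw oppr_eq0.
by case: w {IHw}.
Qed.

Section Words.
Variables (G : groupType) (a b : G).

Definition gen (s : bool) : G := if s then a else b.
Definition word_val (w : word) : G := (\prod_(s <- w) expgz (gen s.1) s.2)%g.

Lemma word_val_cons s w : word_val (s :: w) = (expgz (gen s.1) s.2 * word_val w)%g.
Proof. exact: big_cons. Qed.

Lemma word_val_catrev u v : word_val (catrev u v) = (word_val (rev u) * word_val v)%g.
Proof. by rewrite catrevE /word_val big_cat. Qed.

Lemma word_val_rev_cons s u :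
  word_val (rev (s :: u)) = (word_val (rev u) * expgz (gen s.1) s.2)%g.
Proof. by rewrite rev_cons -cats1 /word_val big_cat big_seq1. Qed.

Lemma word_val_inv w : word_val (rev (inv_word w)) = (word_val w)^-1%g.
Proof.
elim: w => [|s w IHw]; first by rewrite /word_val big_nil invg1.
by rewrite [inv_word _]/= word_val_rev_cons IHw word_val_cons invgM expgzN.
Qed.

Section Weights.
Variables (g : bool -> int -> int) (C : int).
Hypothesis g_bounded : forall s n, `|g s n| <= C.
Hypothesis g_odd : forall s n, g s (- n) = - g s n.

(** The function [g] is left open: [alpha] and [beta] give the values of [f], while the zero
    function leaves just the closure of reduced words under products. *)
Definition weight (w : word) : int := \sum_(s <- w) g s.1 s.2.

Lemma weight_cons s w : weight (s :: w) = g s.1 s.2 + weight w.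
Proof. exact: big_cons. Qed.

Lemma weight_inv w : weight (rev (inv_word w)) = - weight w.
Proof.
rewrite /weight big_rev /= big_map -sumrN.
by apply: eq_bigr => s _; rewrite g_odd.
Qed.

(* [u] is stored backwards, so that cancellation takes place at the two heads.
   By oddness the cancelled syllables contribute nothing to the weights; only
   the last, merged, pair has a defect. *)
Lemma reduced_product u v : reduced u -> reduced v ->
  exists w, [/\ reduced w, word_val w = (word_val (rev u) * word_val v)%g &
                `|weight w - weight u - weight v| <= 3 * C].
Proof.
elim: u v => [|[s n] u IHu] v ru rv.
  exists v; split=> //; first by rewrite [word_val (rev _)]big_nil mul1g.
  (* The bound at a single point yields [0 <= C]. *)
  by rewrite [weight [::]]big_nil; have := g_bounded true 0; lia.
have weight_catrev x y : weight (catrev x y) = weight x + weight y.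
  by rewrite catrevE /weight big_cat big_rev.
have [sv|] := boolP (heads_differ ((s, n) :: u) v).
  exists (catrev ((s, n) :: u) v); split.
  - exact: reduced_catrev.
  - exact: word_val_catrev.
  - by rewrite weight_catrev; have := g_bounded true 0; lia.
case: v rv => [//|[t m] v] rv; rewrite /heads_differ /= negbK => /eqP st; subst t.
move: ru rv; rewrite !reduced_cons /= => /and3P[n0 su ru] /and3P[m0 sv rv].
have [nm0|nm0] := eqVneq (n + m) 0.
  have [w [rw Ew Dw]] := IHu v ru rv; exists w; split=> //.
    rewrite Ew word_val_rev_cons word_val_cons -mulgA; congr (_ * _)%g.
    by rewrite /= mulgA -expgzD nm0 mul1g.
  rewrite !weight_cons /=; have -> : m = - n by lia.
  by rewrite g_odd; lia.
exists (catrev u ((s, n + m) :: v)); split.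
- apply: reduced_catrev => //; first by rewrite reduced_cons; apply/and3P.
  by case: u su {IHu ru} => [|t u] //; rewrite /heads_differ /= eq_sym.
- by rewrite word_val_catrev word_val_rev_cons !word_val_cons expgzD !mulgA.
- rewrite weight_catrev !weight_cons /=.
  by have := g_bounded s n; have := g_bounded s m; have := g_bounded s (n + m); lia.
Qed.

End Weights.
End Words.

(** * Normal forms and centralizers in a free group of rank two *)

Section FreeGroup.
Variables (F : groupType) (a b : F).
Hypothesis free_ab : free_on a b.

Lemma free_on_ext (G : groupType) (h k : F -> G) :
  {morph h : u v / (u * v)%g} -> {morph k : u v / (u * v)%g} ->
  h a = k a -> h b = k b -> h =1 k.
Proof.
move=> hM kM ha hb x; have [l [_ lU]] := free_ab (k a) (k b).
by rewrite -(lU h) // -(lU k).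
Qed.

Lemma free_on_sym : free_on b a.
Proof.
move=> G x y; have [h [[hM ha hb] hU]] := free_ab y x.
by exists h; split=> [|k [kM kb ka]]; [split|apply: hU].
Qed.

(** The universal property gives a morphism from [F] to the subgroup [S]. Followed by the inclusion
    it fixes [a] and [b], hence it is the identity. *)
Lemma free_on_ind (S : {pred F}) : group_closed S -> a \in S -> b \in S ->
  forall x, x \in S.
Proof.
move=> S_closed Sa Sb x; pose T := subgroup_type S_closed.
have [h [[hM ha hb] _]] := free_ab (Sub a Sa : T) (Sub b Sb : T).
have <- : val (h x) = x; last exact: valP.
apply: (@free_on_ext F (fun y => val (h y)) id) => //=.
- by move=> u v; rewrite hM.
- by rewrite ha.
- by rewrite hb.
Qed.

Lemma free_on_word (x : F) : exists2 w, reduced w & x = word_val a b w.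
Proof.
pose S : {pred F} := fun x => `[< exists2 w, reduced w & x = word_val a b w >].
have S_word w : reduced w -> word_val a b w \in S by move=> rw; apply/asboolP; exists w.
have S_gen s : gen a b s \in S.
  have -> : gen a b s = word_val a b [:: (s, 1)].
    by rewrite /word_val big_seq1 /= expg1.
  exact: S_word.
suff : x \in S by move/asboolP.
apply: free_on_ind (S_gen true) (S_gen false) x; split.
  by have -> : 1%g = word_val a b [::]; [rewrite /word_val big_nil|exact: S_word].
move=> _ _ /asboolP[u ru ->] /asboolP[v rv ->].
(* The weight is zero, as only the word matters. The first word is passed backwards, and
   [rev (inv_word v)] represents the inverse of the second factor. *)
have [||||w [rw Ew _]] := @reduced_product F a b (fun _ _ => 0) 0 _ _ (rev u) (rev (inv_word v)).
- by move=> *; rewrite normr0.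
- by move=> *; rewrite oppr0.
- by rewrite reduced_rev.
- by rewrite reduced_rev reduced_inv_word.
by rewrite -word_val_inv -[u]revK -Ew; apply: S_word.
Qed.

(* Ping-pong for the action of [F] on Z^2 by the shears [a |-> (1 2; 0 1)] and
   [b |-> (1 0; 2 1)]: the column [(1, 0)] is fixed by [a], but it is moved off
   the first axis by every reduced word other than the powers of [a]. *)
Lemma centralizer_gen (x : F) : (x * a = a * x)%g -> exists n, x = expgz a n.
Proof.
move=> xa; have [h [[hM ha hb] _]] := free_ab upper_shear lower_shear.
pose act y := bij_fun (h y) (1, 0).
have actM y z : act (y * z)%g = bij_fun (h y) (act z) by rewrite /act hM.
have act_cons s w : act (word_val a b (s :: w)) =
    if s.1 then ((act (word_val a b w)).1 + 2 * s.2 * (act (word_val a b w)).2,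
                 (act (word_val a b w)).2)
    else ((act (word_val a b w)).1,
          (act (word_val a b w)).2 + 2 * s.2 * (act (word_val a b w)).1).
  rewrite word_val_cons actM morph_expgz //; case: s => [[] n] /=.
    by rewrite ha upper_shearX.
  by rewrite hb lower_shearX.
(* Here [|r + 2 m p| >= 2 |p| - |r| > |p|]; this is where the factor 2 in the shears enters. *)
have far (p r m : int) : m != 0 -> `|r| < `|p| -> `|p| < `|r + 2 * m * p|.
  move=> m0 rp; have : `|p| <= `|m * p| by rewrite normrM ler_peMl //; lia.
  have -> : r + 2 * m * p = r + 2 * (m * p) by lia.
  by lia.
(* The head syllable acts last, so the dominant coordinate is the one that its shear changes. The
   condition [v.2 != 0] sets the words headed by [a] apart from the pure powers of [a]. *)
have pingpong w : reduced w ->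
  let v := act (word_val a b w) in
  match w with
  | [::] => v = (1, 0)
  | (true, _) :: w' => if w' is [::] then v = (1, 0) else v.2 != 0 /\ `|v.2| < `|v.1|
  | (false, _) :: _ => `|v.1| < `|v.2|
  end.
  elim: w => [|[s n] w IHw].
    move=> _; rewrite /= /act /word_val big_nil morph_one //.
  rewrite reduced_cons /= act_cons /= => /and3P[n0 sw rw]; have /= := IHw rw.
  case: s sw; case: w rw {IHw} => [|[[] k] w] //= _ _.
  - by move=> ->; rewrite /= mulr0 addr0.
  - by move=> lt12; have := far _ _ _ n0 lt12; lia.
  - by move=> -> /=; have := far 1 0 n n0 isT.
  - case: w => [|t w]; first by move=> ->; apply: far.
    by case=> _ lt21; apply: far.
have [w rw Ex] := free_on_word x.
(* Since [a] fixes (1, 0) and commutes with [x], the point [act x] is fixed by the upper shear. *)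
have act_x : (act x).2 = 0.
  have := actM x a; rewrite xa actM [act a]/act ha /= -/(act x).
  by move: (act x) => [p r]; rewrite /upper_shear /=; case; lia.
have := pingpong w rw; rewrite /= -Ex.
case: w Ex {rw} => [|[[] n] [|t w]] Ex; rewrite ?act_x //.
- by exists 0; rewrite Ex /word_val big_nil.
- by exists n; rewrite Ex /word_val big_seq1.
- by case.
Qed.

(** Under the action by shears, [a ^ n] sends (0, 1) to (2 n, 1). *)
Lemma expgz_gen_eq1 n : expgz a n = 1%g -> n = 0.
Proof.
have [h [[hM ha hb] _]] := free_ab upper_shear lower_shear.
move/(congr1 h); rewrite morph_one // morph_expgz // ha.
move/(congr1 (fun p => bij_fun p (0, 1))); rewrite upper_shearX /=.
by case; lia.
Qed.

Lemma expgz_gen_inj : injective (expgz a).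
Proof.
move=> n m E; have : expgz a (n - m) = 1%g by rewrite expgzD expgzN E mulgV.
by move/expgz_gen_eq1; lia.
Qed.

End FreeGroup.

(** * The quasimorphism *)

(** Regroups the syllables into factors [a ^ n b ^ m], the form in which [f] is given. In a reduced
    word the padding exponent 0 occurs only as the first power of [a] or the last power of [b]. *)
Fixpoint blocks (w : word) : seq (int * int) :=
  match w with
  | [::] => [::]
  | (true, n) :: w' =>
      if w' is (false, m) :: w'' then (n, m) :: blocks w'' else (n, 0) :: blocks w'
  | (false, m) :: w' => (0, m) :: blocks w'
  end.

(** Induction along the recursion of [blocks], which takes two syllables at once when a power of [a]
    is followed by a power of [b]. *)
Lemma word_ind2 (P : word -> Prop) :
  P [::] -> (forall m w, P w -> P ((false, m) :: w)) ->
  (forall n, P [:: (true, n)]) ->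
  (forall n m w, P w -> P [:: (true, n), (false, m) & w]) ->
  (forall n m w, P ((true, m) :: w) -> P [:: (true, n), (true, m) & w]) ->
  forall w, P w.
Proof.
move=> P0 Pb Pa Pab Paa w; have [k] := ubnP (size w).
elim: k w => // k IHk [|[[] n] [|[[] m] w]] //= lt; try by [apply: Pb; apply: IHk].
- by apply: Paa; apply: IHk.
- by apply: Pab; apply: IHk => /=; lia.
Qed.

Section Quasimorphism.
Variables (F : groupType) (a b : F) (alpha beta : int -> int) (f : F -> int).
Hypothesis free_ab : free_on a b.
Hypotheses (alpha_odd : forall n, alpha (- n) = - alpha n)
           (beta_odd : forall n, beta (- n) = - beta n).
Hypothesis fE : forall (k : nat) (n m : nat -> int),
  (1 <= k)%N ->
  (forall i, (1 < i <= k)%N -> n i != 0) ->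
  (forall i, (1 <= i < k)%N -> m i != 0) ->
  f (\prod_(1 <= i < k.+1) (expgz a (n i) * expgz b (m i)))%g =
  \sum_(1 <= i < k.+1) (alpha (n i) + beta (m i)).

Let syllable_weight (s : bool) := if s then alpha else beta.

Lemma odd_at0 (g : int -> int) : (forall n, g (- n) = - g n) -> g 0 = 0.
Proof. by move=> g_odd; have g0 : g 0 = - g 0 by [rewrite -g_odd oppr0]; lia. Qed.

Lemma f_blocks (s : seq (int * int)) :
  (forall i, (0 < i < size s)%N -> (nth (0, 0) s i).1 != 0) ->
  (forall i, (i.+1 < size s)%N -> (nth (0, 0) s i).2 != 0) ->
  f (\prod_(p <- s) (expgz a p.1 * expgz b p.2))%g =
  \sum_(p <- s) (alpha p.1 + beta p.2).
Proof.
(* The formula for [f] needs at least one factor. The empty product is replaced by the single block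
   [(0, 0)], whose weight vanishes by oddness. *)
wlog : s / s != [::].
  case: s => [|p s] wlg; last exact: wlg.
  move=> _ _; have := wlg [:: (0, 0)] isT; rewrite !big_seq1 !big_nil /= mulg1.
  by rewrite (odd_at0 alpha_odd) (odd_at0 beta_odd) addr0; apply; case=> [|[]].
rewrite -size_eq0 -lt0n => s0 hn hm; rewrite !(big_nth (0, 0)).
have := @fE _ (fun i => (nth (0, 0) s i.-1).1) (fun i => (nth (0, 0) s i.-1).2) s0.
rewrite !big_add1 /=; apply.
- by case=> // i lti; apply: hn.
- by case=> // i lti; apply: hm.
Qed.

(** Turns the formula by blocks into a sum over syllables, to which [reduced_product] applies. *)
Lemma f_word (w : word) : reduced w ->
  f (word_val a b w) = weight syllable_weight w.
Proof.
move=> rw.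
have -> : word_val a b w = (\prod_(p <- blocks w) (expgz a p.1 * expgz b p.2))%g.
  rewrite /word_val; elim/word_ind2: w {rw} => [|m w IH|n|n m w IH|n m w IH].
  - by rewrite !big_nil.
  - by rewrite !big_cons IH mul1g.
  - by rewrite !big_seq1 /= mulg1.
  - by rewrite !big_cons IH mulgA.
  - by rewrite big_cons IH [in RHS]big_cons mulg1.
have -> : weight syllable_weight w = \sum_(p <- blocks w) (alpha p.1 + beta p.2).
  have [a0 b0] := (odd_at0 alpha_odd, odd_at0 beta_odd).
  rewrite /weight; elim/word_ind2: w {rw} => [|m w IH|n|n m w IH|n m w IH].
  - by rewrite !big_nil.
  - by rewrite !big_cons IH a0 add0r.
  - by rewrite !big_seq1 /= b0 addr0.
  - by rewrite !big_cons IH addrA.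
  - by rewrite big_cons IH [in RHS]big_cons b0 addr0.
(* The third clause strengthens the induction: once a block is put in front, the former first block
   also needs a nonzero power of [a]. *)
suff [hn hm _] : [/\ forall i, (0 < i < size (blocks w))%N -> (nth (0, 0) (blocks w) i).1 != 0,
  forall i, (i.+1 < size (blocks w))%N -> (nth (0, 0) (blocks w) i).2 != 0 &
  if w is (true, _) :: _ then (nth (0, 0) (blocks w) 0).1 != 0 else true].
  exact: f_blocks.
elim/word_ind2: w rw => [|m w IH|n|n m w IH|n m w IH].
- by split=> //; case.
- rewrite reduced_cons => /and3P[m0 sw rw]; have [hn hm h0] := IH rw; split=> //.
  + case=> [|[|i]] //= lti; last exact: hn.
    by move: sw h0 lti; case: (w) => [|[[] k] w'].
  + by case=> [|i] lti //=; apply: hm.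
- by rewrite reduced_cons => /and3P[n0 _ _]; split=> //; case.
- rewrite !reduced_cons => /and5P[n0 _ m0 sw rw]; have [hn hm h0] := IH rw; split=> //.
  + case=> [|[|i]] //= lti; last exact: hn.
    by move: sw h0 lti; case: (w) => [|[[] k] w'].
  + by case=> [|i] lti //=; apply: hm.
- by rewrite reduced_cons /heads_differ /= andbF.
Qed.

Lemma f_inv x : f x^-1%g = - f x.
Proof.
have [w rw ->] := free_on_word free_ab x.
rewrite -word_val_inv !f_word ?reduced_rev ?reduced_inv_word //.
by apply: weight_inv => -[].
Qed.

Lemma f_quasimorphism (C : int) :
  (forall n, `|alpha n| <= C) -> (forall n, `|beta n| <= C) ->
  forall x y, `|f (x * y)%g - f x - f y| <= 3 * C.
Proof.
move=> alphaC betaC x y.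
have [u ru ->] := free_on_word free_ab x; have [v rv ->] := free_on_word free_ab y.
have wtC s n : `|syllable_weight s n| <= C by case: s.
have wt_odd s n : syllable_weight s (- n) = - syllable_weight s n by case: s => /=.
have ru' : reduced (rev u) by rewrite reduced_rev.
have [w [rw Ew]] := reduced_product a b wtC wt_odd ru' rv.
rewrite revK in Ew; rewrite -Ew !f_word //.
by rewrite {2}/weight big_rev.
Qed.

(** The power is already a product of admissible blocks, without any cancellation. *)
Lemma f_gen_powM n m k : n != 0 -> m != 0 ->
  f ((expgz a n * expgz b m) ^+ k)%g = (alpha n + beta m) *+ k.
Proof.
move=> n0 m0; have := @f_blocks (nseq k (n, m)).
rewrite !big_nseq -Monoid.iteropE -/(natexp _ _) => ->.
- by rewrite iter_addr addr0.
- by rewrite size_nseq => i /andP[_ lti]; rewrite nth_nseq lti.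
- by rewrite size_nseq => i lti; rewrite nth_nseq ltnW.
Qed.

Lemma f_gen1 n : f (expgz a n) = alpha n.
Proof.
have := @f_blocks [:: (n, 0)]; rewrite !big_seq1 /= mulg1 (odd_at0 beta_odd) addr0.
by apply=> //; case.
Qed.

Lemma f_gen2 n : f (expgz b n) = beta n.
Proof.
have := @f_blocks [:: (0, n)]; rewrite !big_seq1 /= mul1g (odd_at0 alpha_odd) add0r.
by apply=> //; case.
Qed.

End Quasimorphism.

(** * Formulas over the two-sorted language *)

Section Formulas.
Variable E : language two_sorts.
Local Notation L := (lang_add base_lang E).

Definition gvar (n : nat) : term L GSort := @Var two_sorts L (GSort, n).
Definition zvar (n : nat) : term L ZSort := @Var two_sorts L (ZSort, n).
Definition mul_term (t u : term L GSort) : term L GSort :=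
  @App two_sorts L (inl mul_symb) (args2 t u).
Definition add_term (t u : term L ZSort) : term L ZSort :=
  @App two_sorts L (inl add_symb) (args2 t u).
Definition f_term (t : term L GSort) : term L ZSort :=
  @App two_sorts L (inl f_symb) (args1 t).
(* [t] to the power [n + 1]. *)
Definition pow_term (t : term L GSort) (n : nat) : term L GSort :=
  iter n (mul_term t) t.

Definition FNot (phi : formula L) := FImp phi (FFalse L).
Definition FAnd (phi psi : formula L) := FNot (FImp phi (FNot psi)).
Definition FEx x (phi : formula L) := FNot (FAll x (FNot phi)).
(** Disjunction is encoded by implication from a negation; the lock keeps simplification from
    unfolding it. *)
Definition FOrs (n : nat) (phi : nat -> formula L) : formula L :=
  locked (foldr (fun k psi => FImp (FNot (phi k)) psi) (FFalse L) (iota 0 n)).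
Definition FAllG (n : nat) (phi : formula L) := FAll (GSort, n) phi.
Definition FAllZ (n : nat) (phi : formula L) := FAll (ZSort, n) phi.
Definition FExG n phi := FEx (GSort, n) phi.
Definition FExZ n phi := FEx (ZSort, n) phi.

Variable N : structure L.
Implicit Types (v : assignment N) (g : nat -> N GSort) (z : nat -> N ZSort).

(** One sequence per sort: the dependent update [dfwith] then becomes the plain update [upd] of a
    sequence. *)
Definition asg g z : assignment N := fun x =>
  let: (s, n) as y := x return N y.1 in
  match s as s' return N s' with GSort => g n | ZSort => z n end.

Definition upd (T : Type) (g : nat -> T) (n : nat) (x : T) : nat -> T :=
  fun k => if k == n then x else g k.

Lemma dfwithG g z n (x : N GSort) :
  dfwith (asg g z) (i := (GSort, n)) x = asg (upd g n x) z.
Proof.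
apply/functional_extensionality_dep => y.
have [<-|] := eqVneq (GSort, n) y; first by rewrite dfwith_in /= /upd eqxx.
move=> ny; rewrite dfwith_out //; case: y ny => [[] k] // ny.
by rewrite /= /upd; have [kn|//] := eqVneq k n; rewrite kn eqxx in ny.
Qed.

Lemma dfwithZ g z n (x : N ZSort) :
  dfwith (asg g z) (i := (ZSort, n)) x = asg g (upd z n x).
Proof.
apply/functional_extensionality_dep => y.
have [<-|] := eqVneq (ZSort, n) y; first by rewrite dfwith_in /= /upd eqxx.
move=> ny; rewrite dfwith_out //; case: y ny => [[] k] // ny.
by rewrite /= /upd; have [kn|//] := eqVneq k n; rewrite kn eqxx in ny.
Qed.

Lemma eval_mul v t u : eval v (mul_term t u) = mul_of (eval v t) (eval v u).
Proof.
apply: (congr1 (@fun_of _ _ N (inl mul_symb))).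
apply: functional_extensionality_dep => i.
by rewrite /args2; case: (i == ord0).
Qed.

Lemma eval_add v t u : eval v (add_term t u) = add_of (eval v t) (eval v u).
Proof.
apply: (congr1 (@fun_of _ _ N (inl add_symb))).
apply: functional_extensionality_dep => i.
by rewrite /args2; case: (i == ord0).
Qed.

Lemma eval_f v t : eval v (f_term t) = f_of (eval v t).
Proof. by []. Qed.

Lemma eval_pow v t n :
  eval v (pow_term t n) = iter n (mul_of (eval v t)) (eval v t).
Proof.
by elim: n => // n IHn; rewrite /pow_term iterS eval_mul -/(pow_term t n) IHn iterS.
Qed.

Lemma eval_gvar g z n : eval (asg g z) (gvar n) = g n.
Proof. by []. Qed.

Lemma eval_zvar g z n : eval (asg g z) (zvar n) = z n.
Proof. by []. Qed.

Lemma sat_eq v s (t u : term L s) : sat v (FEq t u) = (eval v t = eval v u).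
Proof. by []. Qed.

Lemma sat_imp v phi psi : sat v (FImp phi psi) = (sat v phi -> sat v psi).
Proof. by []. Qed.

Lemma sat_not v phi : sat v (FNot phi) = ~ sat v phi.
Proof. by []. Qed.

Lemma sat_and v phi psi : sat v (FAnd phi psi) = (sat v phi /\ sat v psi).
Proof. by rewrite /= -/(not _) -/(not _) not_implyE notK. Qed.

Lemma sat_allG g z n phi :
  sat (asg g z) (FAllG n phi) = forall x, sat (asg (upd g n x) z) phi.
Proof. by apply: eq_forall => x; rewrite dfwithG. Qed.

Lemma sat_allZ g z n phi :
  sat (asg g z) (FAllZ n phi) = forall x, sat (asg g (upd z n x)) phi.
Proof. by apply: eq_forall => x; rewrite dfwithZ. Qed.

Lemma sat_exG g z n phi :
  sat (asg g z) (FExG n phi) = exists x, sat (asg (upd g n x) z) phi.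
Proof.
rewrite sat_not -existsNE /=; apply: eq_exists => x.
by rewrite dfwithG -/(not _) -/(not _) notK.
Qed.

Lemma sat_exZ g z n phi :
  sat (asg g z) (FExZ n phi) = exists x, sat (asg g (upd z n x)) phi.
Proof.
rewrite sat_not -existsNE /=; apply: eq_exists => x.
by rewrite dfwithZ -/(not _) -/(not _) notK.
Qed.

Lemma sat_ors v n phi :
  sat v (FOrs n phi) = exists2 k, (k < n)%N & sat v (phi k).
Proof.
suff Es s : sat v (foldr (fun k psi => FImp (FNot (phi k)) psi) (FFalse L) s) =
    exists2 k, k \in s & sat v (phi k).
  rewrite /FOrs -lock Es; apply/propext; split=> -[k].
    by rewrite mem_iota; exists k.
  by move=> kn ?; exists k => //; rewrite mem_iota.
apply/propext; elim: s => [|k s IHs] /=; first by split=> // -[].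
split=> [imp|[l]].
  case: (pselect (sat v (phi k))) => [sk|/imp/IHs[l ls sl]].
    by exists k; rewrite ?mem_head.
  by exists l; rewrite // inE ls orbT.
rewrite inE => /orP[/eqP-> //|ls] sl _; by apply/IHs; exists l.
Qed.

Definition satE := (sat_exG, sat_exZ, sat_allG, sat_allZ, sat_and, sat_not, sat_imp,
  sat_eq, sat_ors, eval_mul, eval_add, eval_f, eval_pow, eval_gvar, eval_zvar).

End Formulas.

(** * Transfer to an elementary extension *)

Section Transfer.
Variables (F : groupType) (f : F -> int).
Variables (E : language two_sorts) (I : interp E (base_structure f)).
Variable N : structure (lang_add base_lang E).
Variable j : forall s, expand I s -> N s.
Hypothesis j_elementary : elementary_embedding j.

Let M := expand I.
Definition jG (x : F) : N GSort := j (s := GSort) x.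
Definition jZ (n : int) : N ZSort := j (s := ZSort) n.

Local Notation "x *' y" := (mul_of (N := N) x y) (at level 40, left associativity).
Local Notation "m +' n" := (add_of (N := N) m n) (at level 50, left associativity).
Local Notation fN := (f_of (N := N)).
Local Notation e := (jG 1%g).
Local Notation o := (jZ 0).

Lemma transfer phi (g : nat -> F) (z : nat -> int) :
  sat (asg (g : nat -> M GSort) (z : nat -> M ZSort)) phi <->
  sat (asg (jG \o g) (jZ \o z)) phi.
Proof.
have := j_elementary phi (asg (g : nat -> M GSort) (z : nat -> M ZSort)).
suff -> : (fun x => j (asg (g : nat -> M GSort) (z : nat -> M ZSort) x)) =
    asg (jG \o g) (jZ \o z) by [].
by apply: functional_extensionality_dep => -[[] n].
Qed.

Lemma mul_ofM (x y : F) : mul_of (x : M GSort) (y : M GSort) = (x * y)%g.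
Proof. by []. Qed.
Lemma add_ofM (m n : int) : add_of (m : M ZSort) (n : M ZSort) = m + n.
Proof. by []. Qed.
Lemma f_ofM (x : F) : f_of (x : M GSort) = f x.
Proof. by []. Qed.
Lemma iter_mul_ofM (x : F) k : iter k (mul_of (x : M GSort)) x = (x ^+ k.+1)%g.
Proof. by rewrite (iter_mulg k x x) expgSr. Qed.


(** Three quantified variables suffice for all the laws below. Variables of index 3 or more keep the
    values given by [g] and serve as names for constants. *)
Lemma transfer_allG3 phi (g : nat -> F) (z : nat -> int) :
  (forall x y w : F,
     sat (asg (upd (upd (upd g 0 x) 1 y) 2 w : nat -> M GSort) (z : nat -> M ZSort)) phi) ->
  forall x y w : N GSort,
    sat (asg (upd (upd (upd (jG \o g) 0 x) 1 y) 2 w) (jZ \o z)) phi.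
Proof.
move=> phiM x y w; suff: sat (asg (jG \o g) (jZ \o z)) (FAllG 0 (FAllG 1 (FAllG 2 phi))).
  by rewrite sat_allG => /(_ x); rewrite sat_allG => /(_ y); rewrite sat_allG.
apply/transfer; rewrite sat_allG => x'; rewrite sat_allG => y'.
by rewrite sat_allG => w'; apply: phiM.
Qed.

Lemma transfer_allZ3 phi (g : nat -> F) (z : nat -> int) :
  (forall x y w : int,
     sat (asg (g : nat -> M GSort) (upd (upd (upd z 0 x) 1 y) 2 w : nat -> M ZSort)) phi) ->
  forall x y w : N ZSort,
    sat (asg (jG \o g) (upd (upd (upd (jZ \o z) 0 x) 1 y) 2 w)) phi.
Proof.
move=> phiM x y w; suff: sat (asg (jG \o g) (jZ \o z)) (FAllZ 0 (FAllZ 1 (FAllZ 2 phi))).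
  by rewrite sat_allZ => /(_ x); rewrite sat_allZ => /(_ y); rewrite sat_allZ.
apply/transfer; rewrite sat_allZ => x'; rewrite sat_allZ => y'.
by rewrite sat_allZ => w'; apply: phiM.
Qed.

Let ones : nat -> F := fun=> 1%g.
Let zeros : nat -> int := fun=> 0.
Local Notation "'x_ n" := (gvar E n) (at level 8, n at level 2).
Local Notation "'n_ n" := (zvar E n) (at level 8, n at level 2).

Lemma jG_mul x y : jG (x * y)%g = jG x *' jG y.
Proof.
have [+ _] := transfer (FEq 'x_0 (mul_term 'x_1 'x_2)) (nth 1 [:: x * y; x; y])%g zeros.
by rewrite !satE; apply.
Qed.

Lemma jZ_add m n : jZ (m + n) = jZ m +' jZ n.
Proof.
have [+ _] := transfer (FEq 'n_0 (add_term 'n_1 'n_2)) ones (nth 0 [:: m + n; m; n]).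
by rewrite !satE; apply.
Qed.

Lemma jG_inj : injective jG.
Proof.
move=> x y xy; have [_] := transfer (FEq 'x_0 'x_1) (nth 1%g [:: x; y]) zeros.
by rewrite !satE; apply.
Qed.

Lemma jZ_inj : injective jZ.
Proof.
move=> m n mn; have [_] := transfer (FEq 'n_0 'n_1) ones (nth 0 [:: m; n]).
by rewrite !satE; apply.
Qed.

Lemma mul_starA x y w : x *' (y *' w) = x *' y *' w.
Proof.
pose phi := FEq (mul_term 'x_0 (mul_term 'x_1 'x_2)) (mul_term (mul_term 'x_0 'x_1) 'x_2).
have := @transfer_allG3 phi ones zeros _ x y w.
by rewrite !satE; apply=> *; rewrite !satE !mul_ofM mulgA.
Qed.

Lemma mul1_star x : e *' x = x.
Proof.
have := @transfer_allG3 (FEq (mul_term 'x_3 'x_0) 'x_0) ones zeros _ x x x.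
by rewrite !satE; apply=> *; rewrite !satE mul_ofM mul1g.
Qed.

Lemma mul_star1 x : x *' e = x.
Proof.
have := @transfer_allG3 (FEq (mul_term 'x_0 'x_3) 'x_0) ones zeros _ x x x.
by rewrite !satE; apply=> *; rewrite !satE mul_ofM mulg1.
Qed.

Lemma inv_star x : exists y, x *' y = e /\ y *' x = e.
Proof.
pose phi := FExG 4 (FAnd (FEq (mul_term 'x_0 'x_4) 'x_3) (FEq (mul_term 'x_4 'x_0) 'x_3)).
have := @transfer_allG3 phi ones zeros _ x x x.
rewrite !satE => -[x' y' z'|y]; last by rewrite !satE; exists y.
by rewrite !satE; exists (x'^-1)%g; rewrite !satE !mul_ofM mulVg mulgV.
Qed.

Lemma add_starA x y w : x +' (y +' w) = x +' y +' w.
Proof.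
pose phi := FEq (add_term 'n_0 (add_term 'n_1 'n_2)) (add_term (add_term 'n_0 'n_1) 'n_2).
have := @transfer_allZ3 phi ones zeros _ x y w.
by rewrite !satE; apply=> *; rewrite !satE !add_ofM addrA.
Qed.

Lemma add_starC x y : x +' y = y +' x.
Proof.
have := @transfer_allZ3 (FEq (add_term 'n_0 'n_1) (add_term 'n_1 'n_0)) ones zeros _ x y y.
by rewrite !satE; apply=> *; rewrite !satE !add_ofM addrC.
Qed.

Lemma add0_star x : o +' x = x.
Proof.
have := @transfer_allZ3 (FEq (add_term 'n_3 'n_0) 'n_0) ones zeros _ x x x.
by rewrite !satE; apply=> *; rewrite !satE add_ofM add0r.
Qed.

Lemma opp_star x : exists y, x +' y = o.
Proof.
pose phi := FExZ 4 (FEq (add_term 'n_0 'n_4) 'n_3).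
have := @transfer_allZ3 phi ones zeros _ x x x.
rewrite !satE => -[x' y' z'|y]; last by rewrite !satE; exists y.
by rewrite !satE; exists (- x'); rewrite !satE add_ofM /= subrr.
Qed.

Lemma f_star_inv : (forall x, f x^-1%g = - f x) ->
  forall x y, x *' y = e -> fN x +' fN y = o.
Proof.
move=> f_inv x y.
pose phi := FImp (FEq (mul_term 'x_0 'x_1) 'x_3)
  (FEq (add_term (f_term 'x_0) (f_term 'x_1)) 'n_0).
have := @transfer_allG3 phi ones zeros _ x y y.
rewrite !satE; apply=> {x y} x y w; rewrite !satE mul_ofM add_ofM !f_ofM => /mulg1_eq.
by rewrite /upd /= => <-; rewrite f_inv subrr.
Qed.

(* The integers of absolute value at most [D], as values of the variables
   ['n_0, ..., 'n_(2 D)]. *)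
Definition int_window (D k : nat) : int := k%:Z - D%:Z.

(** The base language has no order, so the bound is transferred as a disjunction over the [2 D + 1]
    integers of the window. Hence the defect remains a standard integer in the extension. *)
Lemma f_star_quasi (D : nat) :
  (forall x y, `|f (x * y)%g - f x - f y| <= D%:Z) ->
  forall x y, exists2 d : int, `|d| <= D%:Z &
    fN (x *' y) = fN x +' fN y +' jZ d.
Proof.
move=> f_quasi x y.
pose phi := FOrs D.*2.+1 (fun k => FEq (f_term (mul_term 'x_0 'x_1))
  (add_term (add_term (f_term 'x_0) (f_term 'x_1)) 'n_k)).
have := @transfer_allG3 phi ones (int_window D) _ x y y.
rewrite sat_ors => -[{}x {}y w|k kD].
  have Dxy := f_quasi x y; rewrite sat_ors.
  (* The integer [d] stands at index [D + d] of the window. *)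
  exists (absz (D%:Z + (f (x * y)%g - f x - f y))); first by lia.
  by rewrite !satE mul_ofM !add_ofM !f_ofM /upd /int_window /=; lia.
by rewrite !satE; exists (int_window D k); rewrite // /int_window; lia.
Qed.

Definition in_window D (t : term (lang_add base_lang E) ZSort) :=
  FOrs D.*2.+1 (fun k => FEq t 'n_k).

Lemma sat_in_windowM D g t :
  sat (asg (g : nat -> M GSort) (int_window D : nat -> M ZSort)) (in_window D t) <->
  `|(eval (asg (g : nat -> M GSort) (int_window D : nat -> M ZSort)) t : int)| <= D%:Z.
Proof.
rewrite sat_ors; set v := asg _ _; pose n : int := eval v t.
have En k : sat v (FEq t 'n_k) = (n = int_window D k) by [].
rewrite -[eval v t]/n; split=> [[k kD]|nD].
  by rewrite En => ->; rewrite /int_window; lia.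
by exists (absz (D%:Z + n)); rewrite ?En /int_window; lia.
Qed.

Lemma sat_in_window D (g : nat -> N GSort) t :
  sat (asg g (jZ \o int_window D)) (in_window D t) <->
  exists2 d : int, `|d| <= D%:Z & eval (asg g (jZ \o int_window D)) t = jZ d.
Proof.
rewrite sat_ors; split=> [[k kD]|[d dD Et]].
  by rewrite satE eval_zvar => ->; exists (int_window D k); rewrite // /int_window; lia.
exists (absz (D%:Z + d)); first by lia.
by rewrite satE eval_zvar Et /=; congr jZ; rewrite /int_window; lia.
Qed.

Lemma f_star_centralizer (c : F) (D : nat) :
  (forall x, (x * c = c * x)%g -> `|f x| <= D%:Z) ->
  forall x, x *' jG c = jG c *' x -> exists2 d : int, `|d| <= D%:Z & fN x = jZ d.
Proof.
move=> fc x xc.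
pose phi := FImp (FEq (mul_term 'x_0 'x_3) (mul_term 'x_3 'x_0)) (in_window D (f_term 'x_0)).
have := @transfer_allG3 phi (fun=> c) (int_window D) _ x x x.
rewrite sat_imp sat_in_window !satE; apply=> // {xc}x y w.
by rewrite sat_imp sat_in_windowM !satE => /fc.
Qed.

(** For fixed [B], [n] and [D] the hypothesis is one first-order statement. As the base language has
    no symbol for the inverse, [x'] is a further variable tied to [x] by an equation. An iteration
    [iter n] started at the element itself is its power [n + 1]. *)
Lemma f_star_pow_unbounded (a b : F) (B n D : nat) :
  (forall x y, (x * a = a * x)%g -> (y * b = b * y)%g -> x <> 1%g -> y <> 1%g ->
    `|f ((x ^+ B.+1 * y) ^+ n.+1)%g| <= D%:Z ->
    `|f ((x ^- B.+1 * y) ^+ n.+1)%g| <= D%:Z -> False) ->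
  forall x x' y, x *' jG a = jG a *' x -> y *' jG b = jG b *' y -> x <> e -> y <> e ->
    x *' x' = e ->
    let w u := iter n (mul_of (iter B (mul_of u) u *' y)) (iter B (mul_of u) u *' y) in
    forall d d' : int, `|d| <= D%:Z -> `|d'| <= D%:Z -> fN (w x) = jZ d -> fN (w x') = jZ d' ->
    False.
Proof.
move=> fab x x' y xa yb x1 y1 xx' w d d' dD d'D Ew Ew'.
pose wt u := pow_term (mul_term (pow_term u B) 'x_2) n.
pose phi := FImp (FEq (mul_term 'x_0 'x_3) (mul_term 'x_3 'x_0))
  (FImp (FEq (mul_term 'x_2 'x_4) (mul_term 'x_4 'x_2))
  (FImp (FNot (FEq 'x_0 'x_5)) (FImp (FNot (FEq 'x_2 'x_5))
  (FImp (FEq (mul_term 'x_0 'x_1) 'x_5)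
  (FImp (in_window D (f_term (wt 'x_0)))
  (FNot (in_window D (f_term (wt 'x_1))))))))).
(* Indices 3 and 4 name [a] and [b]; index 5 lies beyond the list and takes the default value 1. *)
have := @transfer_allG3 phi (nth 1%g [:: 1%g; 1%g; 1%g; a; b]) (int_window D) _ x x' y.
rewrite !sat_imp !sat_in_window !satE; apply=> //; last 2 first.
- by exists d.
- by exists d'.
move=> u u' v; rewrite !sat_imp !sat_in_windowM !satE !mul_ofM !iter_mul_ofM /upd /=.
move=> ua vb u1 v1 /mulg1_eq <-; rewrite expVgn => fu fu'.
exact: (fab u v).
Qed.

End Transfer.

(** * Subgroups of bounded index *)

Lemma asg_eta (E : language two_sorts) (N : structure (lang_add base_lang E))
  (v : assignment N) : v = asg (fun n => v (GSort, n)) (fun n => v (ZSort, n)).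
Proof. by apply: functional_extensionality_dep => -[[] n]. Qed.

Section BoundedIndex.
Variables (F : groupType) (f : F -> int).
Variables (E : language two_sorts) (I : interp E (base_structure f)).
Variable N : structure (lang_add base_lang E).
Variable j : forall s, expand I s -> N s.
Hypothesis j_elementary : elementary_embedding j.
Variable K : Type.
Hypothesis N_saturated : saturated K N.

Local Notation jG := (jG j).
Local Notation jZ := (jZ j).
Local Notation "x *' y" := (mul_of (N := N) x y) (at level 40, left associativity).
Local Notation "m +' n" := (add_of (N := N) m n) (at level 50, left associativity).
Local Notation fN := (f_of (N := N)).
Local Notation e := (jG 1%g).
Local Notation o := (jZ 0).

Lemma mul_starI x y y' : x *' y = x *' y' -> y = y'.
Proof.
have [x' [_ x'x]] := inv_star j_elementary x.
move/(congr1 (mul_of x')).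
by rewrite !(mul_starA j_elementary) x'x !(mul1_star j_elementary).
Qed.

Lemma add_starI x y y' : x +' y = x +' y' -> y = y'.
Proof.
have [x' xx'] := opp_star j_elementary x.
move/(congr1 (add_of x')); rewrite !(add_starA j_elementary) (add_starC j_elementary x') xx'.
by rewrite !(add0_star j_elementary).
Qed.

Lemma identity_prod : identity (@prod_op E N) (e, o).
Proof.
move=> [x z]; rewrite /prod_op /= (mul1_star j_elementary) (mul_star1 j_elementary).
by rewrite (add_starC j_elementary z) (add0_star j_elementary).
Qed.

Lemma identity_prodE p : identity (@prod_op E N) p -> p = (e, o).
Proof. by move=> id_p; rewrite -(identity_prod p).1 (id_p (e, o)).2. Qed.

(* Fewer than [K] parameters suffice to name one point of the centralizer of
   [c] in each coset of [G]; the powers of [c] show that the centralizer has a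
   further point, which then lies in the same coset as a named one. *)
Lemma bounded_index_centralizer (c : F) (G H : set (N GSort * N ZSort)) :
  injective (fun n : nat => (c ^+ n)%g) ->
  subgroup (@prod_op E N) G -> @graph_f E N `<=` H ->
  bounded_index (@prod_op E N) K G H ->
  exists u z, [/\ u *' jG c = jG c *' u, u <> e & G (u, z)].
Proof.
move=> c_inj [G1 GM GV] XH G_bounded.
pose pt x : N GSort * N ZSort := (x, fN x).
pose coset x := translate (@prod_op E N) (pt x) G.
pose cosets := (fun h => translate (@prod_op E N) h G) @` H.
have coset_in x : cosets (coset x) by exists (pt x) => //; apply: XH.
pose T := [set x | x *' jG c = jG c *' x].
(* The coset of [jG c] is represented by [jG c] itself, which puts this element among the
   parameters, as [commutes] requires. A coset that misses the centralizer receives the dummy value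
   [e]. *)
have /choice[rep repP] Q : exists r,
    (Q = coset (jG c) -> r = jG c) /\
    (forall x, T x -> coset x = Q -> T r /\ coset r = Q).
  have [->|Qc] := pselect (Q = coset (jG c)); first by exists (jG c).
  have [[x [Tx xQ]]|noQ] := pselect (exists x, T x /\ coset x = Q); first by exists x.
  by exists e; split=> // x Tx xQ; case: noQ; exists x.
have rep_c := (repP _).1 erefl.
pose A : params N := (fun Q => existT (fun s => N s) GSort (rep Q)) @` cosets.
have A_small : card_lt A [set: K].
  have leA : (A #<= cosets)%card by apply: card_image_le.
  case: G_bounded => le_cosets lt_cosets; split; first exact: card_le_trans leA le_cosets.
  by move=> leK; apply: lt_cosets; apply: card_le_trans leK leA.
pose commutes := FEq (mul_term (gvar E 0) (gvar E 1)) (mul_term (gvar E 1) (gvar E 0)).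
pose differs := FNot (FEq (gvar E 0) (gvar E 1)).
pose par r : assignment N := asg (fun=> r) (fun=> o).
(* The type of an element that commutes with [c] and differs from every representative. *)
pose p := (commutes, par (jG c)) |` ((fun Q => (differs, par (rep Q))) @` cosets).
have sat_commutes r x :
    sat (dfwith (par r) (i := (GSort, 0%N)) x) commutes = (x *' r = r *' x).
  by rewrite dfwithG !satE.
have sat_differs r x :
    sat (dfwith (par r) (i := (GSort, 0%N)) x) differs = (x <> r).
  by rewrite dfwithG !satE.
have [||x x_real] := N_saturated (x := (GSort, 0%N)) (p := p) A_small.
- have AQ Q : cosets Q -> A (existT _ GSort (rep Q)) by move=> ?; exists Q.
  have free_ne y : free_in y differs -> y <> (GSort, 0%N) -> y = (GSort, 1%N).
    by case=> [[->|->]|[]].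
  have free_comm y : free_in y commutes -> y <> (GSort, 0%N) -> y = (GSort, 1%N).
    by case=> -[i]; rewrite /args2; case: (i == ord0) => /= ->.
  move=> q [->|[Q Q_in <-]] y /=.
    by move=> /free_comm/[apply] ->; rewrite /= -rep_c; apply: AQ.
  by move=> /free_ne/[apply] ->; apply: AQ.
- move=> p0 p0p p0_fin.
  (* These are the finitely many parameters in [p0]; as the powers of [c] are distinct, one of them
     avoids them all. *)
  pose bad := (fun q : formula _ * assignment N => q.2 (GSort, 1%N)) @` p0.
  have [n bad_n] : exists n : nat, ~ bad (jG (c ^+ n)%g).
    apply: contrapT => /forallNP all_bad.
    pose h n := jG (c ^+ n)%g; apply: infinite_nat.
    apply: sub_finite_set (_ : finite_set (h @^-1` bad)).
      by move=> n _; apply: contrapT; apply: all_bad.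
    apply: finite_preimage; last exact: finite_image.
    by move=> n m _ _ /(jG_inj j_elementary)/c_inj.
  exists (jG (c ^+ n)%g) => q p0q; have [Eq|[Q Q_in Eq]] := p0p q p0q.
    by rewrite Eq sat_commutes -!(jG_mul j_elementary) -expgS -expgSr.
  rewrite -Eq sat_differs => Ex; apply: bad_n; exists q => //.
  by rewrite Ex -Eq.
have Tx : T x by have := x_real (commutes, par (jG c)) (or_introl erefl); rewrite sat_commutes.
have [Tr coset_r] := (repP _).2 x Tx erefl; set r := rep (coset x) in Tr coset_r.
have xr : x <> r.
  rewrite -sat_differs; apply: (x_real (differs, par r)).
  by right; exists (coset x).
have : coset r (pt x).
  rewrite coset_r; exists (e, o); first exact/G1/identity_prod.
  exact: (identity_prod (pt x)).2.
(* Now [x = r *' u], where [r] and [x] both centralize [c] and are distinct. *)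
case=> -[u z] Guz [ru _]; exists u, z; split=> //.
  apply: (@mul_starI r); rewrite !(mul_starA j_elementary) ru.
  by rewrite (Tr : r *' jG c = jG c *' r) -(mul_starA j_elementary) ru.
by move=> u1; apply: xr; rewrite -ru u1 (mul_star1 j_elementary).
Qed.

End BoundedIndex.

(** * The graph of the quasimorphism *)

Lemma graph_definable (E : language two_sorts) (N : structure (lang_add base_lang E)) :
  emptyset_definable2 (@graph_f E N).
Proof.
exists (FEq (f_term (gvar E 0)) (zvar E 1)).
  by move=> y [[_ ->]|->]; [left|right].
by move=> v x n; rewrite (asg_eta v) dfwithG dfwithZ !satE; split=> /esym.
Qed.

Section Graph.
Variables (F : groupType) (f : F -> int).
Variables (E : language two_sorts) (I : interp E (base_structure f)).
Variable N : structure (lang_add base_lang E).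
Variable j : forall s, expand I s -> N s.
Hypothesis j_elementary : elementary_embedding j.

Local Notation jG := (jG j).
Local Notation jZ := (jZ j).
Local Notation "x *' y" := (mul_of (N := N) x y) (at level 40, left associativity).
Local Notation "m +' n" := (add_of (N := N) m n) (at level 50, left associativity).
Local Notation fN := (f_of (N := N)).
Local Notation e := (jG 1%g).
Local Notation o := (jZ 0).
Local Notation X := (@graph_f E N).
Local Notation op := (@prod_op E N).

Variable D : nat.
Hypothesis f_quasi : forall x y, `|f (x * y)%g - f x - f y| <= D%:Z.

(** Symmetry comes from the oddness of [f]. The product of two graph points misses the graph by a
    defect of absolute value at most [D], so the [2 D + 1] translates by the points [(e, jZ d)]
    suffice. *)
Lemma graph_approximate_subgroup :
  (forall x, f x^-1%g = - f x) -> approximate_subgroup op X.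
Proof.
move=> f_inv; split=> [[x n] [y m] /= n_fx [+ _]|].
  move/(identity_prodE j_elementary); rewrite /prod_op /graph_f /= in n_fx * => -[xy nm].
  apply: (@add_starI _ _ _ _ _ _ j_elementary n).
  by rewrite nm n_fx (f_star_inv j_elementary f_inv xy).
exists ((fun k => (e, jZ (int_window D k))) @` `I_D.*2.+1).
  exact/finite_image/finite_II.
move=> _ [[x n] /= n_fx [[y m] /= m_fy <-]]; rewrite /graph_f /= in n_fx m_fy.
have [d dD fxy] := f_star_quasi j_elementary f_quasi x y.
exists (e, jZ (- d)).
  exists (absz (D%:Z - d)) => /=; first by lia.
  by congr (_, jZ _); rewrite /int_window; lia.
exists (x *' y, fN (x *' y)) => //; rewrite /prod_op /= (mul1_star j_elementary); congr pair.
rewrite fxy (add_starC j_elementary) -(add_starA j_elementary) -(jZ_add j_elementary) subrr.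
by rewrite (add_starC j_elementary) (add0_star j_elementary) n_fx m_fy.
Qed.

(** A product of [m + 1] graph points involves [m] multiplications, each with a defect of at most
    [D]. *)
Lemma pow_graph m p : pow_set op X m.+1 p ->
  exists2 d : int, `|d| <= (m * D)%:Z & p.2 = fN p.1 +' jZ d.
Proof.
elim: m p => [|m IHm] p.
  move=> Xp; exists 0 => //.
  by rewrite (add_starC j_elementary) (add0_star j_elementary).
case=> -[x n] /= n_fx [[y k] /IHm[d dD /= ->] <-]; rewrite /graph_f /= in n_fx.
have [d' d'D fxy] := f_star_quasi j_elementary f_quasi x y.
exists (d - d'); first by lia.
rewrite /= fxy n_fx -(add_starA j_elementary) -(jZ_add j_elementary) addrC subrK.
by rewrite -(add_starA j_elementary).
Qed.

(** * Subgroups contained in a power of the graph *)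

Variables (K : Type) (G : set (N GSort * N ZSort)) (m : nat).
Hypothesis G_subgroup : subgroup op G.
Hypothesis G_pow : G `<=` pow_set op X m.+1.

Lemma iter_prod_op n p q :
  iter n (op p) q = (iter n (mul_of p.1) q.1, iter n (add_of p.2) q.2).
Proof. by elim: n => [|n IHn]; rewrite ?iterS ?IHn // -surjective_pairing. Qed.

Lemma subgroup_iter n p q : G p -> G q -> G (iter n (op p) q).
Proof. by case: G_subgroup => _ GM _ Gp Gq; elim: n => // n; apply: GM. Qed.

Lemma iter_add_jZ n k l : iter n (add_of (jZ k)) (jZ l) = jZ (k *+ n + l).
Proof.
elim: n => [|n IHn]; first by rewrite mulr0n add0r.
by rewrite iterS IHn -(jZ_add j_elementary) mulrS addrA.
Qed.

(* On the centralizer of [c] the function is bounded, so its homogenization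
   vanishes there, and an element of [G] has to agree with it. *)
Lemma centralizer_in_subgroup (c : F) (C : nat) u z :
  (forall x, (x * c = c * x)%g -> `|f x| <= C%:Z) ->
  u *' jG c = jG c *' u -> G (u, z) -> z = o.
Proof.
move=> fC uc Guz; have f_cent := f_star_centralizer j_elementary fC.
have [d1 _ fu] := f_cent u uc; have [d2 _] := pow_graph (G_pow Guz).
rewrite /= fu -(jZ_add j_elementary); set k := d1 + d2 => zk.
(* Comparison with the graph bounds [k * n.+1] by [C + m * D], that is, by [n]; this forces
   [k = 0]. *)
pose n := (C + m * D)%N.
have := pow_graph (G_pow (subgroup_iter n Guz Guz)).
rewrite iter_prod_op /= zk iter_add_jZ => -[d4 d4D].
have comm_iter : iter n (mul_of u) u *' jG c = jG c *' iter n (mul_of u) u.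
  elim: n => // n IHn; rewrite iterS -(mul_starA j_elementary) IHn.
  by rewrite !(mul_starA j_elementary) uc.
have [d3 d3C ->] := f_cent _ comm_iter; rewrite -(jZ_add j_elementary).
move=> /(jZ_inj j_elementary); rewrite -mulrSr -mulr_natr => Ek.
have [->//|k0] := eqVneq k 0.
have : n.+1%:Z <= `|k * n.+1%:R| by rewrite normrM natz ler_peMl; lia.
by rewrite Ek /n; lia.
Qed.

Lemma subgroup_pow_false (a b : F) (B Ca Cb : nat) :
  (forall x, (x * a = a * x)%g -> `|f x| <= Ca%:Z) ->
  (forall x, (x * b = b * x)%g -> `|f x| <= Cb%:Z) ->
  injective (fun n : nat => (a ^+ n)%g) -> injective (fun n : nat => (b ^+ n)%g) ->
  (forall x y n, (x * a = a * x)%g -> (y * b = b * y)%g -> x <> 1%g -> y <> 1%g ->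
    `|f ((x ^+ B.+1 * y) ^+ n.+1)%g| <= n%:Z ->
    `|f ((x ^- B.+1 * y) ^+ n.+1)%g| <= n%:Z -> False) ->
  saturated K N -> forall H, X `<=` H -> bounded_index op K G H -> False.
Proof.
move=> fa fb a_inj b_inj fab N_saturated H XH G_bounded.
have cent c (c_inj : injective (fun n : nat => (c ^+ n)%g)) :=
  bounded_index_centralizer j_elementary N_saturated c_inj G_subgroup XH G_bounded.
have [u [z [ua u1 Gu]]] := cent a a_inj; have [v [z' [vb v1 Gv]]] := cent b b_inj.
have zo := centralizer_in_subgroup fa ua Gu; subst z.
have zo := centralizer_in_subgroup fb vb Gv; subst z'.
have [u' [uu' u'u]] := inv_star j_elementary u.
have [_ GM GV] := G_subgroup.
have oo : o +' o = o by rewrite (add0_star j_elementary).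
have Gu' : G (u', o).
  by apply: GV Gu _; split; rewrite /prod_op /= ?uu' ?u'u oo;
    apply: (identity_prod j_elementary).
have iter_o n : iter n (add_of o) o = o by elim: n => // n IHn; rewrite iterS IHn.
(* This is the distance from the graph allowed in [G]. The power [n.+1] is then large enough: a
   nonzero integer times [n.+1] exceeds [n]. *)
pose n := (m * D)%N.
(* All points involved have second coordinate [o], so the value of the function at the power is
   itself within [n] of zero. *)
have bounded_on x : G (x, o) ->
    exists2 d : int, `|d| <= n%:Z & fN (iter n (mul_of (iter B (mul_of x) x *' v))
      (iter B (mul_of x) x *' v)) = jZ d.
  move=> Gx; have Gxv := GM _ _ (subgroup_iter B Gx Gx) Gv.
  have [d dn] := pow_graph (G_pow (subgroup_iter n Gxv Gxv)).
  rewrite !iter_prod_op /= !iter_o oo iter_o => Ed; exists (- d); first by lia.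
  move/(congr1 (add_of (jZ (- d)))): Ed; rewrite (add_starC j_elementary (jZ (- d)) o).
  rewrite (add0_star j_elementary) => ->; rewrite (add_starC j_elementary).
  rewrite -(add_starA j_elementary) -(jZ_add j_elementary) subrr.
  by rewrite (add_starC j_elementary) (add0_star j_elementary).
have [d dn Ed] := bounded_on u Gu; have [d' d'n Ed'] := bounded_on u' Gu'.
have fabn x y := fab x y n.
exact: (f_star_pow_unbounded j_elementary fabn ua vb u1 v1 uu' dn d'n Ed Ed').
Qed.

End Graph.

Lemma finite_int_bounded (A : set int) : finite_set A ->
  exists B : nat, forall n, A n -> `|n| <= B%:Z.
Proof.
move=> /finite_seqP[s ->]; exists (\sum_(n <- s) absz n)%N => n /= ns.
by rewrite -abszE lez_nat (big_rem n) //= leq_addr.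
Qed.

(** * Growth of the quasimorphism along powers in the free group *)

Section TwoGenerators.
Variables (F2 : groupType) (a b : F2) (alpha beta : int -> int) (f : F2 -> int).
Hypothesis free_ab : free_on a b.
Hypotheses (alpha_odd : forall n, alpha (- n) = - alpha n)
           (beta_odd : forall n, beta (- n) = - beta n).
Hypothesis fE : forall (k : nat) (n m : nat -> int),
  (1 <= k)%N ->
  (forall i, (1 < i <= k)%N -> n i != 0) ->
  (forall i, (1 <= i < k)%N -> m i != 0) ->
  f (\prod_(1 <= i < k.+1) (expgz a (n i) * expgz b (m i)))%g =
  \sum_(1 <= i < k.+1) (alpha (n i) + beta (m i)).

(* If both values are small, then [alpha N + beta M = 0] and
   [- alpha N + beta M = 0], where [N] is beyond the zeros of [alpha]. *)
Lemma f_pow_large (B : nat) (x y : F2) n :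
  (forall k, alpha k = 0 -> `|k| <= B%:Z) ->
  (x * a = a * x)%g -> (y * b = b * y)%g -> x <> 1%g -> y <> 1%g ->
  `|f ((x ^+ B.+1 * y) ^+ n.+1)%g| <= n%:Z ->
  `|f ((x ^- B.+1 * y) ^+ n.+1)%g| <= n%:Z -> False.
Proof.
move=> alphaB /(centralizer_gen free_ab)[k ->] /(centralizer_gen (free_on_sym free_ab))[l ->].
move=> k1 l1; have k0 : k != 0 by apply: contra_notN k1 => /eqP->.
have l0 : l != 0 by apply: contra_notN l1 => /eqP->.
rewrite -expgz_natM; set N := k *+ B.+1.
have N_large : B.+1%:Z <= `|N| by rewrite /N -mulr_natr normrM natz ler_peMl; lia.
rewrite -expgzN !(f_gen_powM alpha_odd beta_odd fE) ?oppr_eq0 //; try by lia.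
have small (t : int) : `|t *+ n.+1| <= n%:Z -> t = 0.
  have [//|t0] := eqVneq t 0; rewrite -mulr_natr normrM natz => le_n.
  have : n.+1%:Z <= `|t| * `|n.+1%:Z| by rewrite ler_peMl; lia.
  by lia.
rewrite alpha_odd => /small h1 /small h2.
by have := alphaB N; lia.
Qed.

End TwoGenerators.

Theorem proposition5p10
  (F2 : groupType) (a b : F2) (free_ab : free_on a b)
  (alpha beta : int -> int)
  (alpha_bounded : exists C : int, forall n, `|alpha n| <= C)
  (beta_bounded : exists C : int, forall n, `|beta n| <= C)
  (alpha_odd : forall n : int, alpha (- n) = - alpha n)
  (beta_odd : forall n : int, beta (- n) = - beta n)
  (alpha_neq0 : finite_set [set n | alpha n = 0])
  (f : F2 -> int)
  (fE : forall (k : nat) (n m : nat -> int),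
     (1 <= k)%N ->
     (forall i, (1 < i <= k)%N -> n i != 0) ->
     (forall i, (1 <= i < k)%N -> m i != 0) ->
     f (\prod_(1 <= i < k.+1) (expgz a (n i) * expgz b (m i)))%g =
     \sum_(1 <= i < k.+1) (alpha (n i) + beta (m i)))
  (* [expand I] is an arbitrary expansion of the structure (F2, Z, f) *)
  (E : language two_sorts) (I : interp E (base_structure f))
  (Mstar : structure (lang_add base_lang E))
  (j : forall s, expand I s -> Mstar s) (j_elementary : elementary_embedding j)
  (K : Type) (Mstar_monster : monster_model K Mstar) :
  let X : set (Mstar GSort * Mstar ZSort) := @graph_f E Mstar in
  let H := generated (@prod_op E Mstar) X in
  [/\ emptyset_definable2 X,
      approximate_subgroup (@prod_op E Mstar) X &
      forall H000, is_H000 K H H000 ->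
        forall m : nat, (1 <= m)%N -> ~ (H000 `<=` pow_set (@prod_op E Mstar) X m)].
Proof.
move=> X H; have [Ca alphaC] := alpha_bounded; have [Cb betaC] := beta_bounded.
(* A common bound for [alpha] and [beta], nonnegative by construction, so that the defect bound
   [3 * C] is the natural number [D]. *)
pose C : int := `|Ca| + `|Cb|; pose D := absz (3 * C).
have f_quasi x y : `|f (x * y)%g - f x - f y| <= D%:Z.
  have := @f_quasimorphism _ _ _ _ _ _ free_ab alpha_odd beta_odd fE C _ _ x y.
  have -> : D%:Z = 3 * C by rewrite /D /C; lia.
  by apply=> n; [have := alphaC n|have := betaC n]; rewrite /C; lia.
split; first exact: graph_definable.
  apply: (graph_approximate_subgroup j_elementary f_quasi).
  exact: f_inv free_ab alpha_odd beta_odd fE.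
move=> H000 [[H_subgroup _ _ H_bounded] _] [//|m] _ H_pow.
have [_ Mstar_saturated _] := Mstar_monster.
have [B alphaB] := finite_int_bounded alpha_neq0.
have free_ba := free_on_sym free_ab.
have pow_inj (c d : F2) : free_on c d -> injective (fun n : nat => (c ^+ n)%g).
  move=> free_cd k l; have := @expgz_gen_inj _ _ _ free_cd k%:Z l%:Z.
  by move=> /[apply] -[].
have XH : X `<=` H by move=> p Xp G' [_]; apply.
have fa x : (x * a = a * x)%g -> `|f x| <= (absz Ca)%:Z.
  move=> /(centralizer_gen free_ab)[n ->]; rewrite (f_gen1 alpha_odd beta_odd fE).
  by have := alphaC n; lia.
have fb x : (x * b = b * x)%g -> `|f x| <= (absz Cb)%:Z.
  move=> /(centralizer_gen free_ba)[n ->]; rewrite (f_gen2 alpha_odd beta_odd fE).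
  by have := betaC n; lia.
have f_large x y n := @f_pow_large _ _ _ _ _ _ free_ab alpha_odd beta_odd fE B x y n alphaB.
exact: (subgroup_pow_false j_elementary f_quasi H_subgroup H_pow fa fb
  (pow_inj _ _ free_ab) (pow_inj _ _ free_ba) f_large Mstar_saturated XH H_bounded).
Qed.
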